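(* Let $(x^{\mathrm a}_i,p^{\mathrm a}_i)_{i\ge 0}$ be the analysis mean and analysis variance of the scalar Kalman filter, and let $x^{\mathrm t}_i$ be the truth (all defined in the context). Then $$\lim_{i\to\infty}\mathbb{E}\left[x^{\mathrm a}_i-x^{\mathrm t}_i\right]=0,\qquad \lim_{i\to\infty}\left[\operatorname{Var}\left(x^{\mathrm a}_i-x^{\mathrm t}_i\right)-p^{\mathrm a}_i\right]=0 .$$
   Context: Let $m_0,m_1,\dots$ be nonzero real numbers (the model), $r>0$ (observation error variance), $p_0>0$, $x_0\in\mathbb{R}$ (deterministic initial inputs), and $x^{\mathrm t}_0\in\mathbb{R}$ the deterministic initial truth. The truth evolves by $x^{\mathrm t}_{i+1}=m_i x^{\mathrm t}_i$. The observations $y_0,y_1,\dots$ are independent random variables with $y_i\sim\mathcal N(x^{\mathrm t}_i,r)$. The scalar Kalman filter starts from $x^{\mathrm f}_0=x_0$, $p^{\mathrm f}_0=p_0$ and for $i\ge 0$ computes the analysis $$k_i=\frac{p^{\mathrm f}_i}{p^{\mathrm f}_i+r},\qquad x^{\mathrm a}_i=x^{\mathrm f}_i+k_i(y_i-x^{\mathrm f}_i),\qquad p^{\mathrm a}_i=(1-k_i)p^{\mathrm f}_i,$$ and the forecast $x^{\mathrm f}_{i+1}=m_i x^{\mathrm a}_i$, $p^{\mathrm f}_{i+1}=m_i^2p^{\mathrm a}_i$. Expectation and variance are with respect to the randomness of the observations. *)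

(* Defs.v *)
From mathcomp Require Import all_boot all_order all_algebra finmap.
From mathcomp Require Import all_classical all_reals all_analysis.

Set Implicit Arguments.
Unset Strict Implicit.
Unset Printing Implicit Defensive.

Import Order.TTheory GRing.Theory Num.Theory.
Import numFieldNormedType.Exports.

Local Open Scope classical_set_scope.
Local Open Scope ring_scope.

(** Mutual independence of a family of real random variables: the product
    rule over every finite subfamily. *)
Definition mutually_independent (d : measure_display) (T : measurableType d)
    (R : realType) (P : probability T R) (I : choiceType)
    (X : I -> {RV P >-> R}) : Prop :=
  forall (J : {fset I}) (B : I -> set (measurableTypeR R)),
    (forall j, measurable (B j)) ->
    P (\bigcap_(j in [set` J]) (X j @^-1` B j)) =
    (\prod_(j <- J) P (X j @^-1` B j))%E.

(** [X] has law N(mu, v), with [v] the variance; [normal_prob] takes the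
    standard deviation. The two laws are compared on Borel sets only:
    [distribution] and [normal_prob] are total on [set R], and their values at
    non-measurable sets carry no meaning. *)
Definition has_normal_law (d : measure_display) (T : measurableType d)
    (R : realType) (P : probability T R) (X : {RV P >-> R}) (mu v : R) : Prop :=
  forall B : set (measurableTypeR R), measurable B ->
    distribution P X B = normal_prob mu (Num.sqrt v) B.

Section ScalarKalmanFilter.
Context {R : realType}.
Variable m : nat -> R.

Fixpoint truth (xt0 : R) (i : nat) : R :=
  if i is j.+1 then m j * truth xt0 j else xt0.

Variables (r p0 x0 : R).

Definition gain (p : R) : R := p / (p + r).

Definition update_mean (k x y : R) : R := x + k * (y - x).

Definition update_var (k p : R) : R := (1 - k) * p.

Fixpoint forecast_var (i : nat) : R :=
  if i is j.+1 then
    m j ^+ 2 * update_var (gain (forecast_var j)) (forecast_var j)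
  else p0.

Definition kalman_gain (i : nat) : R := gain (forecast_var i).

Definition analysis_var (i : nat) : R :=
  update_var (kalman_gain i) (forecast_var i).

Fixpoint forecast_mean (y : nat -> R) (i : nat) : R :=
  if i is j.+1 then
    m j * update_mean (kalman_gain j) (forecast_mean y j) (y j)
  else x0.

Definition analysis_mean (y : nat -> R) (i : nat) : R :=
  update_mean (kalman_gain i) (forecast_mean y i) (y i).

(* The two fixpoints have to inline the analysis step; these lemmas give the
   forecast recursion in terms of the analysis. *)
Lemma forecast_varS (i : nat) :
  forecast_var i.+1 = m i ^+ 2 * analysis_var i.
Proof. by []. Qed.

Lemma forecast_meanS (y : nat -> R) (i : nat) :
  forecast_mean y i.+1 = m i * analysis_mean y i.
Proof. by []. Qed.

End ScalarKalmanFilter.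

(** The error x^a_i - x^t_i as a random variable on the sample space. *)
Definition analysis_error (T : Type) (R : realType) (m : nat -> R)
    (r p0 x0 xt0 : R) (y : nat -> T -> R) (i : nat) : T -> R :=
  fun w => analysis_mean m r p0 x0 (fun j => y j w) i - truth m xt0 i.

(* Main.v *)
Require Import Defs.
From mathcomp Require Import all_boot all_order all_algebra finmap.
From mathcomp Require Import all_classical all_reals all_analysis.
From mathcomp Require Import measurable_realfun ring.

(** The forecast and analysis errors are affine in the independent observations.
    Averaging the recursion, the mean error is a_i (x0 - x^t_0) for a scalar
    factor a_i, and, by the Joseph form p^a = (1 - k)^2 p^f + k^2 r, the variance
    satisfies the same recursion as p^a except that it starts at 0 instead of p0;
    hence Var - p^a_i = - a_i^2 p0. Both limits therefore reduce to a_i --> 0. *)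

Set Implicit Arguments.
Unset Strict Implicit.
Unset Printing Implicit Defensive.

Import Order.TTheory GRing.Theory Num.Theory.
Import numFieldNormedType.Exports.

Local Open Scope classical_set_scope.
Local Open Scope ring_scope.

(** * Gaussian moments *)

Lemma is_derive_gauss_fun (R : realType) (x : R) :
  is_derive x 1 (@gauss_fun R) (- 2 * x * gauss_fun x).
Proof.
rewrite /gauss_fun; apply: is_derive_eq.
rewrite /GRing.scale /=; ring.
Qed.

(** For [x > 0] the value lies between [0] and [x^-1], because
    [expR (x ^+ 2) >= 1 + x ^+ 2 >= x ^+ 2]. *)
Lemma cvg_mulr_gauss_fun (R : realType) : x * gauss_fun x @[x --> +oo] --> (0 : R).
Proof.
apply: (@squeeze_cvgr _ _ _ _ (cst 0) (fun x : R => x^-1)).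
- near=> x.
  have x0 : 0 < x by near: x; exact: nbhs_pinfty_gt.
  rewrite mulr_ge0 ?gauss_fun_ge0 ?(ltW x0)//=.
  have /(le_trans _) h : 1 + x ^+ 2 <= expR (x ^+ 2) by exact: expR_ge1Dx.
  rewrite /gauss_fun expRN -[leRHS]mul1r ler_pdivrMr ?expR_gt0//.
  rewrite mul1r mulrC ler_pdivlMr//.
  by rewrite h// -expr2 lerDr.
- exact: cvg_cst.
- by apply/(gtr0_cvgV0 (f := id)) => //; exact: nbhs_pinfty_gt.
Unshelve. all: by end_near. Qed.

(** The square of this nonnegative integral tends to [pi / 4]; continuity of the square root gives
    the limit. *)
Lemma cvg_integral0_gauss (R : realType) :
  (\int[@lebesgue_measure R]_(t in `[0, x]) gauss_fun t)%R @[x --> +oo]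
    --> (Num.sqrt pi / 2 : R).
Proof.
have sqrt4 : Num.sqrt (4 : R) = 2.
  by rewrite (_ : 4 = 2 ^+ 2) ?sqrtr_sqr ?ger0_norm// expr2 -natrM.
rewrite -sqrt4 -sqrtrV// -sqrtrM ?pi_ge0//.
rewrite (_ : (fun x : R => _) = fun x : R =>
    Num.sqrt ((@gauss_integral_proof.integral0_gauss R x) ^+ 2)); last first.
  apply/funext => x; rewrite sqrtr_sqr ger0_norm//.
  exact: gauss_integral_proof.integral0_gauss_ge0.
apply: (continuous_cvg _ (@sqrt_continuous R _)).
exact: gauss_integral_proof.cvg_integral0_gauss_sqr.
Qed.

(** Integration by parts in antiderivative form: since [gauss_fun] has derivative
    [- 2 * x * gauss_fun x], the function [F] below satisfies [F' = x ^+ 2 * gauss_fun x], with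
    [F 0 = 0] and limit [Num.sqrt pi / 4] at infinity. *)
Lemma integral0y_sqr_gauss (R : realType) :
  (\int[@lebesgue_measure R]_(x in `[0%R, +oo[) (x ^+ 2 * gauss_fun x)%:E =
   (Num.sqrt pi / 4)%:E)%E.
Proof.
pose I (x : R) := (\int[@lebesgue_measure R]_(t in `[0, x]) gauss_fun t)%R.
pose F x := 2^-1 * (I x - x * gauss_fun x).
have cg : continuous (@gauss_fun R) by exact: continuous_gauss_fun.
have intg (b : R) : lebesgue_measure.-integrable `[0, b] (EFin \o @gauss_fun R).
  apply: continuous_compact_integrable; first exact: segment_compact.
  exact: continuous_subspaceT.
have dI (x : R) : 0 < x -> is_derive x 1 I (gauss_fun x).
  move=> x0.
  (* The right end [x + 1] only serves to make [x] an interior point of the interval. *)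
  have [d1 d2] := @continuous_FTC1_closed R (@gauss_fun R) 0 x (x + 1)
    (ltr_pwDr ltr01 (lexx x)) (intg _) x0 (cg x).
  by split => //; rewrite -derive1E.
have dF (x : R) : 0 < x -> is_derive x 1 F (x ^+ 2 * gauss_fun x).
  move=> x0; have := dI _ x0; have := is_derive_gauss_fun x => ? ?.
  by rewrite /F; apply: is_derive_eq; rewrite /GRing.scale /=; field.
apply: (etrans (@ge0_continuous_FTC2y R (fun x => x ^+ 2 * gauss_fun x) F 0
  (Num.sqrt pi / 4) _ _ _ _ _ _)).
- by move=> x _; rewrite mulr_ge0 ?sqr_ge0 ?gauss_fun_ge0.
- apply: continuous_subspaceT => x; apply: cvgM; first exact: exprn_continuous.
  exact: cg.
- rewrite (_ : Num.sqrt pi / 4 = 2^-1 * (Num.sqrt pi / 2 - 0)) ; last by field.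
  apply: cvgMl_tmp; apply: cvgB; first exact: cvg_integral0_gauss.
  exact: cvg_mulr_gauss_fun.
- by move=> x x0; have [] := dF x x0.
- apply: cvgMl_tmp; apply: cvgB.
    have I0 : I 0 = 0 by rewrite /I set_itv1 Rintegral_set1.
    rewrite I0; apply: cvg_at_right_filter.
    exact: parameterized_integral_cvg_left ltr01 (intg 1).
  apply: cvg_at_right_filter; apply: cvgM; [exact: cvg_id|exact: cg].
- by move=> x; rewrite in_itv/= andbT => x0; rewrite derive1E; have [] := dF x x0.
- by rewrite /F /I set_itv1 Rintegral_set1 mul0r subrr mulr0 sube0.
Qed.

(** The integral over the line is the sum of the integrals of [H x] and [H (- x)] over the
    nonnegative half-line, and replacing [G] by its reflection swaps the two summands. *)
Lemma ge0_integral_opp (R : realType) (G : R -> R) :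
  continuous G -> (forall x, 0 <= G x) ->
  (\int[@lebesgue_measure R]_x (G (- x))%:E = \int[@lebesgue_measure R]_x (G x)%:E)%E.
Proof.
move=> cG G0.
have split (H : R -> R) : continuous H -> (forall x, 0 <= H x) ->
    (\int[@lebesgue_measure R]_x (H x)%:E =
     \int[@lebesgue_measure R]_(x in `[0%R, +oo[) (H x)%:E +
     \int[@lebesgue_measure R]_(x in `[0%R, +oo[) (H (- x)%R)%:E)%E.
  move=> cH H0.
  have mH : measurable_fun [set: R] H by exact: continuous_measurable_fun.
  rewrite -(setUv `[0%R, +oo[%classic) ge0_integral_setU//=; last 4 first.
  - exact: measurableC.
  - by apply/measurable_EFinP; rewrite setUv.
  - by move=> x _; rewrite lee_fin.
  - exact/disj_setPCl.
  congr +%E; rewrite setCitvr.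
  rewrite integral_itv_bndo_bndc; last exact/measurable_EFinP/measurable_funTS.
  rewrite -{1}oppr0 ge0_integration_by_substitutionNy//.
  exact: continuous_subspaceT.
rewrite (split G)// (split (fun x => G (- x)))//; last first.
  by move=> x; apply: continuous_comp; [exact: opp_continuous|exact: cG].
rewrite addeC; congr +%E.
by under eq_integral do rewrite opprK.
Qed.

(** Change of variables along the increasing affine map [x |-> (x - m) / (s * Num.sqrt 2)], whose
    constant derivative is absorbed by the normalisation of the density. *)
Lemma integral_normal_pdf_standardize (R : realType) (m s : R) (G : R -> R) :
  0 < s -> continuous G -> (forall x, 0 <= G x) ->
  (\int[@lebesgue_measure R]_x
     (G ((x - m) / (s * Num.sqrt 2)) * normal_pdf m s x)%:E =
   (Num.sqrt pi)^-1%:E * \int[@lebesgue_measure R]_x (G x * gauss_fun x)%:E)%E.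
Proof.
move=> s0 cG G0.
have sqrtpi : 0 < Num.sqrt pi :> R by rewrite sqrtr_gt0 pi_gt0.
have c0 : 0 < s * Num.sqrt 2 by rewrite mulr_gt0// sqrtr_gt0.
pose F (x : R) := (x - m) / (s * Num.sqrt 2).
have dF (x : R) : is_derive x 1 F (s * Num.sqrt 2)^-1.
  by rewrite /F; apply: is_derive_eq; rewrite /GRing.scale /=; ring.
have F'E : F^`()%classic = cst (s * Num.sqrt 2)^-1.
  by apply/funext => x; rewrite derive1E; have [] := dF x.
have pdfE x : normal_pdf m s x =
    (Num.sqrt pi)^-1 * (gauss_fun (F x) * (s * Num.sqrt 2)^-1).
  have s_neq0 : s != 0 by rewrite gt_eqF.
  rewrite normal_pdfE// /normal_peak /normal_fun /gauss_fun /F.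
  have -> : - (x - m) ^+ 2 / (s ^+ 2 *+ 2) = - ((x - m) / (s * Num.sqrt 2)) ^+ 2.
    by rewrite exprMn exprVn exprMn sqr_sqrtr// mulr_natr mulNr.
  have -> : Num.sqrt (s ^+ 2 * pi *+ 2) = s * Num.sqrt pi * Num.sqrt 2.
    rewrite -mulr_natr sqrtrM; last exact: mulr_ge0 (sqr_ge0 s) (pi_ge0 R).
    by rewrite sqrtrM ?sqr_ge0// sqrtr_sqr gtr0_norm.
  by rewrite !invfM; ring.
have cGg : continuous (fun x => G x * gauss_fun x).
  by move=> x; apply: cvgM; [exact: cG|exact: continuous_gauss_fun].
rewrite (@increasing_ge0_integration_by_substitutionT R F
  (fun x => G x * gauss_fun x)) ?F'E//.
- rewrite -ge0_integralZl//=.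
  + apply: eq_integral => x _; rewrite -EFinM pdfE /F; congr EFin.
    by rewrite !fctE; ring.
  + apply/measurable_EFinP; apply: measurable_funM => //.
    apply: continuous_measurable_fun => x.
    apply: (continuous_comp (f := F)); last exact: cGg.
    apply/differentiable_continuous/derivable1_diffP.
    by have [] := dF x.
  + by move=> x _; rewrite lee_fin !mulr_ge0 ?gauss_fun_ge0 ?invr_ge0 ?(ltW c0).
- by move=> x y xy; rewrite /F ltr_pM2r ?invr_gt0// ltrD2r.
- by move=> x; exact: cvg_cst.
- exact: is_cvg_cst.
- exact: is_cvg_cst.
- by apply/gt0_cvgMlNy; [rewrite invr_gt0|exact: cvg_addrr_Ny].
- by apply/gt0_cvgMly; [rewrite invr_gt0|exact: cvg_addrr].
- by move=> x; rewrite mulr_ge0 ?gauss_fun_ge0.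
Qed.

(** The Radon-Nikodym derivative of [normal_prob] and [normal_pdf] have the same integral over every
    measurable set, hence agree almost everywhere. *)
Lemma ge0_integral_normal_prob (R : realType) (m s : R) (f : R -> \bar R) :
  measurable_fun setT f -> (forall x, (0 <= f x)%E) ->
  (\int[normal_prob m s]_x f x =
   \int[@lebesgue_measure R]_x (f x * (normal_pdf m s x)%:E))%E.
Proof.
move=> mf f0.
have dom := normal_prob_dominates m s.
rewrite -(Radon_Nikodym_SigmaFinite.change_of_variables dom)//.
apply: ae_eq_integral => //.
- apply: emeasurable_funM => //.
  by apply: measurable_int; exact: Radon_Nikodym_SigmaFinite.f_integrable.
- apply: emeasurable_funM => //; apply/measurable_EFinP.
  exact: measurable_normal_pdf.
- apply: ae_eqe_mul2l; apply: integral_ae_eq => //.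
  + exact: Radon_Nikodym_SigmaFinite.f_integrable.
  + by apply/measurable_EFinP; exact: measurable_normal_pdf.
  + by move=> E _ mE; rewrite -Radon_Nikodym_SigmaFinite.f_integral.
Qed.

Lemma integral_sqr_gauss (R : realType) :
  (\int[@lebesgue_measure R]_x (x ^+ 2 * gauss_fun x)%:E = (Num.sqrt pi / 2)%:E)%E.
Proof.
rewrite ge0_symfun_integralT.
- rewrite (_ : [set x | _] = `[0, +oo[%classic); last first.
    by apply/seteqP; split => x/=; rewrite in_itv/= andbT.
  by rewrite integral0y_sqr_gauss -EFinM; congr EFin; field.
- by move=> x; rewrite mulr_ge0 ?sqr_ge0 ?gauss_fun_ge0.
- by move=> x; apply: cvgM; [exact: exprn_continuous|exact: continuous_gauss_fun].
- by move=> x /=; rewrite /gauss_fun sqrrN.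
Qed.

(** Reduces moments of [X] to integrals against [gauss_fun]: pass to the law of [X], insert its
    density, standardize. It is applied below to the square and to the positive and negative parts,
    all nonnegative and continuous. *)
Lemma ge0_expectation_normal (d : measure_display) (T : measurableType d)
    (R : realType) (P : probability T R) (X : {RV P >-> R}) (mu v : R) (G : R -> R) :
  has_normal_law X mu v -> 0 < v -> continuous G -> (forall x, 0 <= G x) ->
  ('E_P[fun w => G (X w - mu)%R] =
   (Num.sqrt pi)^-1%:E * \int[@lebesgue_measure R]_x
     (G (Num.sqrt v * Num.sqrt 2 * x) * gauss_fun x)%:E)%E.
Proof.
move=> lawX v0 cG G0.
have s0 : 0 < Num.sqrt v by rewrite sqrtr_gt0.
have c0 : 0 < Num.sqrt v * Num.sqrt 2 by rewrite mulr_gt0// sqrtr_gt0.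
(* normal_prob lives on measurableTypeR R, a measurable type distinct from (though
   convertible to) the one carried by R in the type of X. *)
have mX : measurable_fun setT (X : T -> measurableTypeR R) by exact: (measurable_funPT X).
pose X' : {mfun T >-> measurableTypeR R} :=
  @mfun_Sub _ _ T (measurableTypeR R) _ (mem_set mX).
have cGm : continuous (fun x => G (x - mu)).
  move=> x; apply: (continuous_comp (f := fun x => x - mu)); last exact: cG.
  by apply: cvgB; [exact: cvg_id|exact: cvg_cst].
have mG : measurable_fun [set: measurableTypeR R] (fun x : R => (G (x - mu))%:E).
  by apply/measurable_EFinP; exact: continuous_measurable_fun.
rewrite unlock (_ : (\int[P]_w _)%E =
    (\int[distribution P X']_x (G (x - mu))%:E)%E); last first.
  by rewrite ge0_integral_distribution// => x; rewrite lee_fin.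
rewrite (eq_measure_integral (normal_prob mu (Num.sqrt v))); last first.
  by move=> A mA _; exact: lawX.
rewrite ge0_integral_normal_prob//; last by move=> x; rewrite lee_fin.
(* Rescaling the argument of [G] by [Num.sqrt v * Num.sqrt 2] cancels the division made by the
   standardization. *)
rewrite -(@integral_normal_pdf_standardize R mu (Num.sqrt v)
  (fun x => G (Num.sqrt v * Num.sqrt 2 * x)))//.
- by apply: eq_integral => x _; rewrite -EFinM mulrCA divff ?mulr1// gt_eqF.
- move=> x.
  apply: (continuous_comp (f := fun x => Num.sqrt v * Num.sqrt 2 * x)); last exact: cG.
  by apply: cvgMl_tmp; exact: cvg_id.
Qed.

Lemma expectation_sqr_normal (d : measure_display) (T : measurableType d)
    (R : realType) (P : probability T R) (X : {RV P >-> R}) (mu v : R) :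
  has_normal_law X mu v -> 0 < v ->
  ('E_P[fun w => ((X w - mu) ^+ 2)%R] = v%:E)%E.
Proof.
move=> lawX v0.
rewrite (ge0_expectation_normal (G := fun x => x ^+ 2) lawX)//.
- under eq_integral do rewrite exprMn -mulrA EFinM.
  rewrite ge0_integralZl//.
  + rewrite integral_sqr_gauss -!EFinM; congr EFin.
    rewrite exprMn !sqr_sqrtr ?(ltW v0)//; field.
    by rewrite gt_eqF// sqrtr_gt0 pi_gt0.
  + apply/measurable_EFinP; apply: measurable_funM; first exact: measurable_funX.
    exact: measurable_gauss_fun.
  + by move=> x _; rewrite lee_fin mulr_ge0 ?sqr_ge0 ?gauss_fun_ge0.
- exact: exprn_continuous.
- by move=> x; exact: sqr_ge0.
Qed.

(** * Square-integrability, and mean and variance of a normal variable *)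

Lemma Lfun2_integral_sqr (d : measure_display) (T : measurableType d)
    (R : realType) (mu : {measure set T -> \bar R}) (f : T -> R) :
  measurable_fun setT f -> (\int[mu]_x (f x ^+ 2)%:E < +oo)%E ->
  f \in Lfun mu 2%:E.
Proof.
move=> mf intf; rewrite inE; apply/andP; split; rewrite inE//=.
rewrite /finite_norm unlock /Lnorm poweR_lty//.
by under eq_integral do
  rewrite /= powR_mulrn// -normrX ger0_norm ?sqr_ge0//.
Qed.

Lemma Lfun2_scale (d : measure_display) (T : measurableType d)
    (R : realType) (P : probability T R) (a : R) (f : T -> R) :
  f \in Lfun P 2%:E -> a \o* f \in Lfun P 2%:E.
Proof. by move=> f2; apply: Lfun_scale; rewrite ?ler1n. Qed.

Lemma Lfun2_add (d : measure_display) (T : measurableType d)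
    (R : realType) (P : probability T R) (f g : T -> R) :
  f \in Lfun P 2%:E -> g \in Lfun P 2%:E -> f \+ g \in Lfun P 2%:E.
Proof. by move=> f2 g2; rewrite rpredD ?lee1n. Qed.

Lemma Lfun2_Lfun1 (d : measure_display) (T : measurableType d)
    (R : realType) (P : probability T R) (f : T -> R) :
  f \in Lfun P 2%:E -> f \in Lfun P 1.
Proof. by apply: Lfun_subset12; exact: fin_num_measure. Qed.

(** The centred variable has second moment [v], and adding back the constant [mu] preserves
    square-integrability under a probability. *)
Lemma Lfun2_normal (d : measure_display) (T : measurableType d)
    (R : realType) (P : probability T R) (X : {RV P >-> R}) (mu v : R) :
  has_normal_law X mu v -> 0 < v -> (X : T -> R) \in Lfun P 2%:E.
Proof.
move=> lawX v0.
have Xmu2 : (X \- cst mu : T -> R) \in Lfun P 2%:E.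
  apply: Lfun2_integral_sqr; first exact: measurable_funB.
  have := expectation_sqr_normal lawX v0; rewrite unlock => ->.
  exact: ltry.
rewrite (_ : (X : T -> R) = (X \- cst mu) \+ cst mu); last first.
  by apply/funext => w /=; rewrite subrK.
by apply: Lfun2_add => //; exact: Lfun_cst.
Qed.

(** The law of [X - mu] is symmetric, so its positive and negative parts have equal integrals; both
    are finite and cancel. *)
Lemma expectation_normal (d : measure_display) (T : measurableType d)
    (R : realType) (P : probability T R) (X : {RV P >-> R}) (mu v : R) :
  has_normal_law X mu v -> 0 < v -> ('E_P[X] = mu%:E)%E.
Proof.
move=> lawX v0.
have X1 := Lfun2_Lfun1 (Lfun2_normal lawX v0).
pose c : R := Num.sqrt v * Num.sqrt 2.
(* [G] is the positive part and [G (- x)] the negative part. *)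
pose G (x : R) := Num.max x 0.
have cG : continuous G.
  by move=> x; apply: continuous_max; [exact: cvg_id|exact: cvg_cst].
have G0 x : 0 <= G x by rewrite le_max lexx orbT.
have cGN : continuous (fun x => G (- x)).
  by move=> x; apply: continuous_comp; [exact: opp_continuous|exact: cG].
have sym : ('E_P[fun w => G (- (X w - mu))%R] = 'E_P[fun w => G (X w - mu)%R])%E.
  rewrite (ge0_expectation_normal (G := fun x => G (- x)) lawX)//.
  rewrite (ge0_expectation_normal lawX)//; congr *%E.
  (* Reflecting the Gaussian integral exchanges the two parts, as [gauss_fun] is even. *)
  rewrite -/c -[RHS](@ge0_integral_opp R (fun x => G (c * x) * gauss_fun x)).
  + by apply: eq_integral => x _; rewrite mulrN /gauss_fun sqrrN.
  + move=> x; apply: cvgM; last exact: continuous_gauss_fun.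
    apply: (continuous_comp (f := fun x => c * x)); last exact: cG.
    by apply: cvgMl_tmp; exact: cvg_id.
  + by move=> x; rewrite mulr_ge0 ?gauss_fun_ge0.
have Xmu1 : (X \- cst mu : T -> R) \in Lfun P 1 by rewrite rpredB ?Lfun_cst.
have E0 : ('E_P[(X \- cst mu)%R] = 0)%E.
  rewrite [in LHS]unlock integralE.
  have -> : (\int[P]_w (fun w => (X w - mu)%:E)^\- w =
      \int[P]_w (fun w => (X w - mu)%:E)^\+ w)%E.
    move: sym; rewrite unlock => sym.
    transitivity (\int[P]_w (G (- (X w - mu)))%:E)%E.
      by apply: eq_integral => w _; rewrite funenegE -EFinN -EFin_max.
    by rewrite sym; apply: eq_integral => w _; rewrite funeposE -EFin_max.
  rewrite subee//.
  apply: integrable_pos_fin_num => //; exact/Lfun1_integrable.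
move: E0; rewrite expectationB ?Lfun_cst// expectation_cst.
rewrite -(fineK (expectation_fin_num X1)) -EFinB => -[] /eqP.
by rewrite subr_eq0 => /eqP ->.
Qed.

Lemma variance_normal (d : measure_display) (T : measurableType d)
    (R : realType) (P : probability T R) (X : {RV P >-> R}) (mu v : R) :
  has_normal_law X mu v -> 0 < v -> ('V_P[X] = v%:E)%E.
Proof.
move=> lawX v0.
rewrite -(expectation_sqr_normal lawX v0) /variance.
rewrite [in LHS]unlock (expectation_normal lawX v0).
by congr expectation; apply/funext => w; rewrite /= expr2.
Qed.

(** * Independence *)

Lemma mutually_independent_pair (d : measure_display) (T : measurableType d)
    (R : realType) (P : probability T R) (I : choiceType)
    (X : I -> {RV P >-> R}) (i j : I) (A B : set (measurableTypeR R)) :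
  mutually_independent X -> i != j -> measurable A -> measurable B ->
  (P (X i @^-1` A `&` X j @^-1` B) = P (X i @^-1` A) * P (X j @^-1` B))%E.
Proof.
move=> indX ij mA mB.
(* The product rule is used for the family equal to [A] at [i] and to [B] at every other index. *)
have := indX [fset i; j]%fset (fun k => if k == i then A else B).
rewrite big_fsetU1 ?inE//= big_seq_fset1 eqxx eq_sym (negbTE ij) => <-; last first.
  by move=> k; case: ifP.
congr (P _); apply/seteqP; split => [w /= [Ai Bj] k /=|w /= h].
  by rewrite !inE => /orP[/eqP ->|/eqP ->]; rewrite ?eqxx// eq_sym (negbTE ij).
split.
  by have := h i; rewrite /= !inE eqxx/=; exact.
by have := h j; rewrite /= !inE eqxx orbT eq_sym (negbTE ij)/=; exact.
Qed.

(** The product rule on rectangles makes the joint law of [(X, Y)] the product of the two laws;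
    Fubini then factors the expectation of [X * Y]. *)
Lemma covariance_independent (d : measure_display) (T : measurableType d)
    (R : realType) (P : probability T R) (X Y : {RV P >-> R}) :
  (forall A B : set (measurableTypeR R), measurable A -> measurable B ->
    P (X @^-1` A `&` Y @^-1` B) = P (X @^-1` A) * P (Y @^-1` B))%E ->
  (X : T -> R) \in Lfun P 2%:E -> (Y : T -> R) \in Lfun P 2%:E ->
  covariance P X Y = 0%E.
Proof.
move=> indXY X2 Y2.
have Pfin : P setT \is a fin_num by exact: fin_num_measure.
have X1 := Lfun_subset12 Pfin X2; have Y1 := Lfun_subset12 Pfin Y2.
have XY1 := Lfun2_mul_Lfun1 X2 Y2.
rewrite covarianceE//.
suff -> : ('E_P[(X : T -> R) * (Y : T -> R)] = 'E_P[X] * 'E_P[Y])%E.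
  by rewrite subee// fin_numM ?expectation_fin_num.
pose Z0 (w : T) := (X w, Y w).
have mZ : measurable_fun setT Z0 by exact: measurable_fun_pair.
pose Z : {mfun T >-> (R * R)%type} := mfun_Sub (mem_set mZ).
pose f (z : R * R) : \bar R := (z.1 * z.2)%:E.
have mf : measurable_fun [set: R * R] f.
  by apply/measurable_EFinP; apply: measurable_funM.
pose m1 := distribution P X.
pose m2 := distribution P Y.
have prodE (V : set (R * R)) : measurable V ->
    (m1 \x m2)%E V = distribution P Z V.
  by apply: product_measure_unique => A B mA mB; rewrite -indXY.
have iXY : P.-integrable setT (f \o Z) by exact/Lfun1_integrable.
have iX : P.-integrable setT (EFin \o (X : T -> R)) by exact/Lfun1_integrable.
have iY : P.-integrable setT (EFin \o (Y : T -> R)) by exact/Lfun1_integrable.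
have mE : measurable_fun [set: R] (@EFin R).
  by apply/measurable_EFinP.
have EX : (\int[m1]_x x%:E = 'E_P[X])%E.
  by rewrite unlock -(@integral_distribution _ _ _ _ _ _ X EFin).
have EY : (\int[m2]_x x%:E = 'E_P[Y])%E.
  by rewrite unlock -(@integral_distribution _ _ _ _ _ _ Y EFin).
have i1 : m1.-integrable setT (@EFin R) by apply: integrable_pushforward.
have i2 : m2.-integrable setT (@EFin R) by apply: integrable_pushforward.
have /integrableP[_ iZ] : (distribution P Z).-integrable [set: R * R] f.
  exact: integrable_pushforward.
(* Integrability transfers from the joint law, which coincides with the product measure on
   measurable sets. *)
have if_ : (m1 \x m2)%E.-integrable [set: R * R] f.
  apply/integrableP; split => //.
  rewrite (eq_measure_integral (distribution P Z)) => [//|V mV _].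
  exact: prodE.
transitivity (\int[m1]_x \int[m2]_y (x * y)%:E)%E; last first.
  rewrite -EX -EY.
  under eq_integral => x _ do
    (under eq_integral => y _ do rewrite EFinM; rewrite integralZl//).
  by rewrite EY -(fineK (expectation_fin_num Y1)) integralZr.
rewrite (integral12_prod_meas1 if_).
rewrite (eq_measure_integral (distribution P Z)); last by move=> A mA _; exact: prodE.
by rewrite integral_distribution// unlock.
Qed.

(** * The Kalman filter *)

Lemma forecast_var_gt0 (R : realType) (m : nat -> R) (r p0 : R) (i : nat) :
  (forall i, m i != 0) -> 0 < r -> 0 < p0 -> 0 < forecast_var m r p0 i.
Proof.
move=> m0 r0 p00; elim: i => [//|i /= IH].
have pr0 : 0 < forecast_var m r p0 i + r by rewrite addr_gt0.
rewrite mulr_gt0 ?exprn_even_gt0//= mulr_gt0//.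
by rewrite /gain subr_gt0 ltr_pdivrMr// mul1r ltrDl.
Qed.

(** The factor by which the initial error x0 - x^t_0 enters the forecast error
    at step i once the observation noise is averaged out. *)
Fixpoint forecast_factor {R : realType} (m : nat -> R) (r p0 : R) (i : nat) : R :=
  if i is j.+1 then
    m j * ((1 - kalman_gain m r p0 j) * forecast_factor m r p0 j)
  else 1.

Definition analysis_factor {R : realType} (m : nat -> R) (r p0 : R) (i : nat) : R :=
  (1 - kalman_gain m r p0 i) * forecast_factor m r p0 i.

(* With b i := analysis_factor i ^+ 2 / p^a_i one has b (i+1) = (1 - k_(i+1)) b i,
   so that b converges and its decrements dominate analysis_factor ^+ 2 / r. *)
Lemma cvg_analysis_factor (R : realType) (m : nat -> R) (r p0 : R) :
  (forall i, m i != 0) -> 0 < r -> 0 < p0 ->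
  analysis_factor m r p0 i @[i --> \oo] --> (0 : R).
Proof.
move=> m0 r0 p00.
pose a := analysis_factor m r p0; pose q := analysis_var m r p0.
pose k := kalman_gain m r p0; pose p := forecast_var m r p0.
have p_gt0 i : 0 < p i by exact: forecast_var_gt0.
have qE i : q i = p i * r / (p i + r).
  rewrite /q /analysis_var /update_var /kalman_gain /gain -/p.
  by field; rewrite gt_eqF// addr_gt0.
have q_gt0 i : 0 < q i by rewrite qE divr_gt0 ?mulr_gt0 ?addr_gt0.
have k1E i : 1 - k i = r / (p i + r).
  by rewrite /k /kalman_gain /gain -/p; field; rewrite gt_eqF// addr_gt0.
pose b i := a i ^+ 2 / q i.
have b_ge0 i : 0 <= b i by rewrite divr_ge0 ?sqr_ge0 ?ltW.
(* With [q i.+1 = (1 - k i.+1) * p i.+1] and [p i.+1 = m i ^+ 2 * q i], the model factor [m i]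
   cancels, as does one factor [1 - k i.+1]. *)
have bS i : b i.+1 = r / (p i.+1 + r) * b i.
  have aS : a i.+1 = (1 - k i.+1) * (m i * a i) by [].
  have qp : q i = p i.+1 / m i ^+ 2.
    by rewrite (_ : p i.+1 = m i ^+ 2 * q i)// mulrAC mulfV ?mul1r// expf_neq0.
  rewrite /b (qE i.+1) aS k1E qp; field.
  by rewrite m0 !gt_eqF ?addr_gt0.
(* Since [q = r * k] and [b i - b i.+1 = k i.+1 * b i], the left side is [1 - k i.+1] times the
   right side. *)
have bound i : a i.+1 ^+ 2 <= r * (b i - b i.+1).
  rewrite (_ : a i.+1 ^+ 2 = b i.+1 * q i.+1); last first.
    by rewrite /b divfK// gt_eqF.
  rewrite qE bS.
  have pi_gt0 := p_gt0 i.+1; have pr_gt0 : 0 < p i.+1 + r by rewrite addr_gt0.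
  rewrite (_ : r * (b i - _) = r * (p i.+1 / (p i.+1 + r)) * b i); last first.
    by field; rewrite gt_eqF.
  rewrite (_ : r / _ * b i * _ = r / (p i.+1 + r) * (r * (p i.+1 / (p i.+1 + r)) * b i)).
    rewrite ler_piMl//; last by rewrite ler_pdivrMr// mul1r lerDr ltW.
    by apply: mulr_ge0 => //; rewrite mulr_ge0 ?divr_ge0// ltW.
  by field; rewrite gt_eqF.
have b_noninc : nonincreasing_seq b.
  apply/nonincreasing_seqP => i; rewrite -subr_ge0 -(pmulr_rge0 _ r0).
  by rewrite (le_trans _ (bound i))// sqr_ge0.
have cb : cvgn b.
  by apply: nonincreasing_is_cvgn => //; exists 0 => _ [i _ <-].
have sq0 : a i ^+ 2 @[i --> \oo] --> (0 : R).
  (* The bound concerns index [i.+1], whence the shift; the decrements of the convergent sequence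
     [b] tend to [0]. *)
  rewrite -(cvg_shiftS (fun i => a i ^+ 2)).
  apply: (@squeeze_cvgr _ _ _ _ (cst 0) (fun i => r * (b i - b i.+1))).
  - by apply: nearW => i; rewrite sqr_ge0 bound.
  - exact: cvg_cst.
  - rewrite -(mulr0 r) -(subrr (limn b)); apply: cvgMl_tmp.
    by apply: cvgB => //; rewrite (cvg_shiftS b).
apply/norm_cvg0P.
rewrite -(sqrtr0 R) (_ : (fun i => _) = fun i => Num.sqrt (a i ^+ 2)).
  exact: (continuous_cvg _ (@sqrt_continuous R _)).
by apply/funext => i; rewrite sqrtr_sqr.
Qed.

(** * Mean and variance of the forecast and the analysis *)

Section forecast.
Context (R : realType) (m : nat -> R) (r p0 x0 xt0 : R)
  (m_neq0 : forall i, m i != 0) (r_gt0 : 0 < r) (p0_gt0 : 0 < p0)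
  (d : measure_display) (T : measurableType d) (P : probability T R)
  (y : nat -> {RV P >-> R})
  (y_indep : mutually_independent y)
  (y_normal : forall i, has_normal_law (y i) (truth m xt0 i) r).

Local Notation xf i := (fun w => forecast_mean m r p0 x0 (fun j => y j w) i).
Local Notation xa i := (fun w => analysis_mean m r p0 x0 (fun j => y j w) i).
Local Notation k := (kalman_gain m r p0).

(** Exhibits the analysis as a linear combination of random variables, the form to which the rules
    for expectation, variance and covariance apply. *)
Lemma analysis_meanE i : xa i = ((1 - k i) \o* xf i) \+ (k i \o* y i).
Proof.
by apply/funext => w; rewrite /analysis_mean /update_mean /=; ring.
Qed.

Lemma forecast_meanSE i : xf i.+1 = m i \o* xa i.
Proof. by apply/funext => w; rewrite /= mulrC. Qed.

Lemma Lfun2_observation i : (y i : T -> R) \in Lfun P 2%:E.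
Proof. exact: Lfun2_normal (y_normal i) r_gt0. Qed.

Lemma Lfun2_forecast_mean i : xf i \in Lfun P 2%:E.
Proof.
elim: i => [|i IH]; first exact: Lfun_cst.
rewrite forecast_meanSE; apply: Lfun2_scale; rewrite analysis_meanE.
apply: Lfun2_add; apply: Lfun2_scale; [exact: IH|exact: Lfun2_observation].
Qed.

Lemma Lfun2_analysis_mean i : xa i \in Lfun P 2%:E.
Proof.
rewrite analysis_meanE; apply: Lfun2_add; apply: Lfun2_scale.
  exact: Lfun2_forecast_mean.
exact: Lfun2_observation.
Qed.

(** The forecast at step [i] involves only observations of index below [i]. The variance computation
    uses [l = i], but the induction must carry all later [l]. *)
Lemma covariance_forecast_mean i l : (i <= l)%N -> covariance P (xf i) (y l) = 0%E.
Proof.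
elim: i l => [|i IH] l il; first exact: covariance_cst_l.
have y2 := Lfun2_observation; have f2 := Lfun2_forecast_mean.
have a2 := Lfun2_analysis_mean.
have covZ a f : f \in Lfun P 2%:E -> covariance P f (y l) = 0%E ->
    covariance P (a \o* f) (y l) = 0%E.
  move=> f2' cf; have fy := Lfun2_mul_Lfun1 f2' (y2 l).
  by rewrite (covarianceZl _ (Lfun2_Lfun1 f2') (Lfun2_Lfun1 (y2 l)) fy) cf mule0.
rewrite forecast_meanSE covZ// analysis_meanE covarianceDl ?Lfun2_scale//.
rewrite !covZ ?adde0// ?IH// 1?ltnW//.
apply: covariance_independent => // A B mA mB.
by apply: mutually_independent_pair => //; rewrite neq_ltn il.
Qed.

(** The observation is unbiased, so the update keeps the truth and multiplies the mean error by
    [1 - k i]. The forecast formula is a premise so that this step can serve inside the induction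
    that proves it. *)
Lemma expectation_analysis i :
  ('E_P[xf i] = (truth m xt0 i + forecast_factor m r p0 i * (x0 - xt0))%:E)%E ->
  ('E_P[xa i] = (truth m xt0 i + analysis_factor m r p0 i * (x0 - xt0))%:E)%E.
Proof.
have y2 := Lfun2_observation; have f2 := Lfun2_forecast_mean.
move=> IH; rewrite analysis_meanE expectationD ?Lfun2_Lfun1 ?Lfun2_scale//.
rewrite !expectationZl ?Lfun2_Lfun1// IH (expectation_normal (y_normal i))//.
by rewrite -!EFinM -EFinD /analysis_factor; congr EFin; ring.
Qed.

Lemma expectation_forecast i :
  ('E_P[xf i] = (truth m xt0 i + forecast_factor m r p0 i * (x0 - xt0))%:E)%E.
Proof.
elim: i => [|i /expectation_analysis IH].
  by rewrite expectation_cst /=; congr EFin; ring.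
rewrite forecast_meanSE expectationZl ?Lfun2_Lfun1 ?Lfun2_analysis_mean// IH.
by rewrite -EFinM /= -/(analysis_factor m r p0 i); congr EFin; ring.
Qed.

(** As [xf i] and [y i] are uncorrelated, the variance becomes [(1 - k i) ^+ 2] times that of the
    forecast plus [k i ^+ 2 * r]; the Joseph form identifies the part not containing [p0] explicitly
    with [analysis_var]. *)
Lemma variance_analysis i :
  ('V_P[xf i] = (forecast_var m r p0 i - forecast_factor m r p0 i ^+ 2 * p0)%:E)%E ->
  ('V_P[xa i] = (analysis_var m r p0 i - analysis_factor m r p0 i ^+ 2 * p0)%:E)%E.
Proof.
have y2 := Lfun2_observation; have f2 := Lfun2_forecast_mean.
move=> IH; rewrite analysis_meanE varianceD ?Lfun2_scale//.
rewrite !varianceZ// IH (variance_normal (y_normal i))//.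
rewrite covarianceZl; last 3 first.
- exact: Lfun2_Lfun1.
- by apply: Lfun2_Lfun1; exact: Lfun2_scale.
- by apply: Lfun2_mul_Lfun1 => //; exact: Lfun2_scale.
rewrite (covarianceZr _ (Lfun2_Lfun1 (f2 i)) (Lfun2_Lfun1 (y2 i)))//; last first.
  exact: Lfun2_mul_Lfun1.
rewrite covariance_forecast_mean//.
rewrite !mule0 adde0 -!EFinM -EFinD /analysis_var /update_var /analysis_factor.
rewrite /kalman_gain /gain; congr EFin; field.
by rewrite gt_eqF// addr_gt0// forecast_var_gt0.
Qed.

Lemma variance_forecast i :
  ('V_P[xf i] = (forecast_var m r p0 i - forecast_factor m r p0 i ^+ 2 * p0)%:E)%E.
Proof.
elim: i => [|i /variance_analysis IH].
  (* The initial forecast is deterministic: its variance [0] is [p0 - 1 ^+ 2 * p0]. *)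
  by rewrite variance_cst /=; congr EFin; ring.
rewrite forecast_meanSE varianceZ ?Lfun2_analysis_mean// IH.
rewrite -EFinM /= -/(analysis_var m r p0 i) -/(analysis_factor m r p0 i).
rewrite -/(kalman_gain m r p0 i) -/(analysis_factor m r p0 i).
by congr EFin; rewrite /analysis_var; ring.
Qed.

End forecast.

Theorem mainTheorem1 (R : realType) (m : nat -> R) (r p0 x0 xt0 : R)
    (m_neq0 : forall i, m i != 0) (r_gt0 : 0 < r) (p0_gt0 : 0 < p0)
    (d : measure_display) (T : measurableType d) (P : probability T R)
    (y : nat -> {RV P >-> R})
    (y_indep : mutually_independent y)
    (y_normal : forall i, has_normal_law (y i) (truth m xt0 i) r) :
  ('E_P[analysis_error m r p0 x0 xt0 y i] @[i --> \oo] --> 0)%E /\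
  ('V_P[analysis_error m r p0 x0 xt0 y i] - (analysis_var m r p0 i)%:E
     @[i --> \oo] --> 0)%E.
Proof.
pose a := analysis_factor m r p0.
have a_cvg0 : a i @[i --> \oo] --> (0 : R) by exact: cvg_analysis_factor.
have errE i : analysis_error m r p0 x0 xt0 y i =
    (fun w => analysis_mean m r p0 x0 (fun j => y j w) i) \- cst (truth m xt0 i) by [].
have xa2 i : (fun w => analysis_mean m r p0 x0 (fun j => y j w) i) \in Lfun P 2%:E.
  exact: Lfun2_analysis_mean.
split.
(* The truth cancels, leaving the initial error damped by [a i]. *)
- rewrite (_ : (fun i => _) = EFin \o (fun i => a i * (x0 - xt0))).
    apply: cvg_EFin; first exact: nearW.
    by rewrite -(mul0r (x0 - xt0)); exact: cvgMr_tmp.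
  apply/funext => i; rewrite errE expectationB ?Lfun_cst ?Lfun2_Lfun1//.
  rewrite expectation_cst (expectation_analysis r_gt0 y_normal); last first.
    exact: expectation_forecast.
  by rewrite -EFinB /= addrAC subrr add0r.
(* Subtracting the deterministic truth leaves the variance unchanged, and [analysis_var] cancels. *)
- rewrite (_ : (fun i => _) = EFin \o (fun i => - (a i * a i * p0))).
    apply: cvg_EFin; first exact: nearW.
    rewrite -oppr0 -(mul0r p0) -(mulr0 0).
    by apply: cvgN; apply: cvgMr_tmp; apply: cvgM.
  apply/funext => i; rewrite errE varianceB_cst_r//.
  rewrite (variance_analysis m_neq0 r_gt0 p0_gt0 y_indep y_normal); last first.
    exact: variance_forecast.
  by rewrite -EFinB /= /a; congr EFin; ring.
Qed.
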